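(* Let $m\geq 1$ be an integer and let $\{R_i\}_{i=1,\dots,m}$ be a family of coherent commutative rings. Then $$\mathrm{G\text{-}wdim}\Big(\prod_{i=1}^m R_i\Big)=\sup\{\mathrm{G\text{-}wdim}(R_i)\mid 1\leq i\leq m\}.$$
   Context: All rings are commutative with identity element and all modules are unital. A ring is coherent if every finitely generated ideal is finitely presented. An $R$-module $M$ is Gorenstein flat if there is an exact sequence of flat $R$-modules $\mathbf{F}=\cdots\to F_1\to F_0\to F^0\to F^1\to\cdots$ such that $M\cong \mathrm{Im}(F_0\to F^0)$ and such that $-\otimes_R I$ leaves $\mathbf{F}$ exact for every injective $R$-module $I$. The Gorenstein flat dimension $\mathrm{Gfd}_R(M)$ of an $R$-module $M$ is the least integer $n\geq 0$ such that there is an exact sequence $0\to G_n\to\cdots\to G_0\to M\to 0$ with all $G_i$ Gorenstein flat, and $\infty$ if no such $n$ exists. The Gorenstein weak dimension of $R$ is $\mathrm{G\text{-}wdim}(R)=\sup\{\mathrm{Gfd}_R(M)\mid M \text{ an } R\text{-module}\}\in\mathbb{N}\cup\{\infty\}$. *)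

(* Defs.v *)
From HB Require Import structures.
From mathcomp Require Import all_boot all_order all_algebra.
From mathcomp Require Import boolp classical_sets.
From mathcomp.multinomials Require Import freeg.

Set Implicit Arguments.
Unset Strict Implicit.
Unset Printing Implicit Defensive.
Import GRing.Theory.
Local Open Scope ring_scope.

(* Rings are comPzRingType: the zero ring is not excluded.  Modules are all
   the lmodTypes (of a fixed universe level). *)

(* {dffun ...} carries no ring structure in the library. *)
Definition prod_ring (I : finType) (R : I -> comPzRingType) : Type :=
  {dffun forall i, R i}.

Section ProdRing.
Variables (I : finType) (R : I -> comPzRingType).
Implicit Types x y z : prod_ring R.

HB.instance Definition _ := Choice.copy (prod_ring R) {dffun forall i, R i}.

Definition prod_zero : prod_ring R := [ffun i => 0 : R i].
Definition prod_opp x : prod_ring R := [ffun i => - x i].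
Definition prod_add x y : prod_ring R := [ffun i => x i + y i].
Definition prod_one : prod_ring R := [ffun i => 1 : R i].
Definition prod_mul x y : prod_ring R := [ffun i => x i * y i].

Fact prod_addA : associative prod_add.
Proof. by move=> x y z; apply/ffunP => i; rewrite !ffunE addrA. Qed.
Fact prod_addC : commutative prod_add.
Proof. by move=> x y; apply/ffunP => i; rewrite !ffunE addrC. Qed.
Fact prod_add0 : left_id prod_zero prod_add.
Proof. by move=> x; apply/ffunP => i; rewrite !ffunE add0r. Qed.
Fact prod_addN : left_inverse prod_zero prod_opp prod_add.
Proof. by move=> x; apply/ffunP => i; rewrite !ffunE addNr. Qed.

HB.instance Definition _ := GRing.isZmodule.Build (prod_ring R)
  prod_addA prod_addC prod_add0 prod_addN.

Fact prod_mulA : associative prod_mul.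
Proof. by move=> x y z; apply/ffunP => i; rewrite !ffunE mulrA. Qed.
Fact prod_mulC : commutative prod_mul.
Proof. by move=> x y; apply/ffunP => i; rewrite !ffunE mulrC. Qed.
Fact prod_mul1 : left_id prod_one prod_mul.
Proof. by move=> x; apply/ffunP => i; rewrite !ffunE mul1r. Qed.
Fact prod_mulD : left_distributive prod_mul +%R.
Proof. by move=> x y z; apply/ffunP => i; rewrite !ffunE mulrDl. Qed.

HB.instance Definition _ := GRing.Zmodule_isComPzRing.Build (prod_ring R)
  prod_mulA prod_mulC prod_mul1 prod_mulD.
End ProdRing.

Section Submodule.
Variables (R : pzRingType) (M : lmodType R) (S : submodClosed M).

Record submod := Submod { submod_val : M; _ : submod_val \in S }.

HB.instance Definition _ := [isSub for submod_val].
HB.instance Definition _ := [Choice of submod by <:].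
HB.instance Definition _ := [SubChoice_isSubLmodule of submod by <:].
End Submodule.

Section Image.
Variables (R : pzRingType) (M N : lmodType R) (f : {linear M -> N}).

Definition image_pred : {pred N} := fun y => `[< exists x, f x = y >].

Fact image_submod_closed : subsemimod_closed image_pred.
Proof.
split; last first.
  move=> a _ /asboolP[x <-]; apply/asboolP.
  by exists (a *: x); rewrite linearZ.
split; first by apply/asboolP; exists 0; rewrite linear0.
move=> _ _ /asboolP[x <-] /asboolP[y <-]; apply/asboolP.
by exists (x + y); rewrite linearD.
Qed.

HB.instance Definition _ :=
  GRing.isSubmodClosed.Build R N image_pred image_submod_closed.

Definition image_mod : lmodType R := submod image_pred.
End Image.

Definition isomorphic (R : pzRingType) (M N : lmodType R) : Prop :=
  exists f : {linear M -> N}, bijective f.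

Definition surj (A B : Type) (f : A -> B) : Prop := forall y, exists x, f x = y.

Definition exact_at (A B C : zmodType) (f : A -> B) (g : B -> C) : Prop :=
  forall y, g y = 0 <-> exists x, f x = y.

Definition finitely_generated (R : pzRingType) (M : lmodType R) : Prop :=
  exists n (a : 'I_n -> M), forall x, exists c : 'I_n -> R, x = \sum_i c i *: a i.

Definition finitely_presented (R : pzRingType) (M : lmodType R) : Prop :=
  exists p q (g : {linear 'rV[R]_p -> 'rV[R]_q}) (f : {linear 'rV[R]_q -> M}),
    exact_at g f /\ surj f.

(* The ideals of R are the submodules of the regular module R^o. *)
Definition coherent (R : comPzRingType) : Prop :=
  forall I : submodClosed R^o,
    finitely_generated (submod I) -> finitely_presented (submod I).

(* The tensor product, as an abelian group: the free abelian group on A * B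
   modulo the bilinearity relations. *)
Section Tensor.
Variables (R : comPzRingType) (A B : lmodType R).

Local Notation free := {freeg (A * B)%type / int}.

Inductive tensor_rel : free -> Prop :=
| TensorZero : tensor_rel 0
| TensorSub u v : tensor_rel u -> tensor_rel v -> tensor_rel (u - v)
| TensorDl a a' b : tensor_rel (<< (a + a', b) >> - << (a, b) >> - << (a', b) >>)
| TensorDr a b b' : tensor_rel (<< (a, b + b') >> - << (a, b) >> - << (a, b') >>)
| TensorZ r a b : tensor_rel (<< (r *: a, b) >> - << (a, r *: b) >>).

Definition tensor_relb : {pred free} := fun u => `[< tensor_rel u >].

Fact tensor_rel_closed : zmod_closed tensor_relb.
Proof.
split; first exact/asboolP/TensorZero.
by move=> u v /asboolP hu /asboolP hv; apply/asboolP/TensorSub.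
Qed.

HB.instance Definition _ :=
  GRing.isZmodClosed.Build free tensor_relb tensor_rel_closed.

Definition tensor : zmodType := Quotient.quot tensor_relb.

Definition tens (a : A) (b : B) : tensor := \pi_(tensor)%qT << (a, b) >>.
End Tensor.

Section TensorMap.
Variables (R : comPzRingType) (A A' B : lmodType R) (f : {linear A -> A'}).

Definition free_map (u : {freeg (A * B)%type / int}) :
    {freeg (A' * B)%type / int} :=
  fglift (fun p => << (f p.1, p.2) >>) u.

Lemma free_map_is_zmod_morphism : zmod_morphism free_map.
Proof. exact: lift_is_additive. Qed.

HB.instance Definition _ :=
  GRing.isZmodMorphism.Build _ _ free_map free_map_is_zmod_morphism.

Lemma free_mapU p : free_map << p >> = << (f p.1, p.2) >>.
Proof. by rewrite /free_map liftU scale1r. Qed.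

Lemma free_map_rel u : tensor_rel u -> tensor_rel (free_map u).
Proof.
elim=> {u} [|u v _ hu _ hv|a a' b|a b b'|r a b].
- by rewrite raddf0; apply: TensorZero.
- by rewrite raddfB; apply: TensorSub.
- by rewrite !raddfB /= !free_mapU /= linearD; apply: TensorDl.
- by rewrite !raddfB /= !free_mapU /=; apply: TensorDr.
- by rewrite !raddfB /= !free_mapU /= linearZ; apply: TensorZ.
Qed.

Definition tensor_map (t : tensor A B) : tensor A' B :=
  \pi_(tensor A' B)%qT (free_map (repr t)).

Lemma tensor_mapE u :
  tensor_map (\pi_(tensor A B)%qT u) = \pi_(tensor A' B)%qT (free_map u).
Proof.
apply/eqP; rewrite -Quotient.idealrBE -raddfB; apply/asboolP/free_map_rel.
by apply/asboolP; rewrite -[asbool _]/(_ \in @tensor_relb _ A B)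
  Quotient.idealrBE reprK.
Qed.

Lemma tensor_map_tens a b : tensor_map (tens a b) = tens (f a) b.
Proof. by rewrite /tens tensor_mapE free_mapU. Qed.

Lemma tensor_map_is_zmod_morphism : zmod_morphism tensor_map.
Proof.
elim/quotW=> u; elim/quotW=> v.
by rewrite -raddfB !tensor_mapE !raddfB.
Qed.

HB.instance Definition _ :=
  GRing.isZmodMorphism.Build _ _ tensor_map tensor_map_is_zmod_morphism.
End TensorMap.

(* M is flat when - (x) M is an exact functor. *)
Definition flat (R : comPzRingType) (M : lmodType R) : Prop :=
  forall (A B C : lmodType R) (f : {linear A -> B}) (g : {linear B -> C}),
    exact_at f g ->
    exact_at (tensor_map (B := M) f) (tensor_map (B := M) g).

Definition injective_module (R : comPzRingType) (E : lmodType R) : Prop :=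
  forall (A B : lmodType R) (i : {linear A -> B}) (u : {linear A -> E}),
    injective i -> exists v : {linear B -> E}, forall a, v (i a) = u a.

(* The two-sided complex F is indexed by int with increasing differential:
   F_i is F (- i) and F^i is F (i + 1), so that F_0 -> F^0 is d 0. *)
Definition gorenstein_flat (R : comPzRingType) (M : lmodType R) : Prop :=
  exists (F : int -> lmodType R) (d : forall n : int, {linear F n -> F (n + 1)}),
    [/\ forall n, flat (F n),
        forall n, exact_at (d n) (d (n + 1)),
        isomorphic M (image_mod (d 0)) &
        forall E : lmodType R, injective_module E ->
          forall n, exact_at (tensor_map (B := E) (d n))
                             (tensor_map (B := E) (d (n + 1)))].

(* 0 -> G_n -> ... -> G_0 -> M -> 0, extended by zero beyond degree n. *)
Definition gorenstein_flat_resolution (R : comPzRingType) (M : lmodType R)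
    (n : nat) : Prop :=
  exists (G : nat -> lmodType R) (d : forall i, {linear G i.+1 -> G i})
         (e : {linear G 0%N -> M}),
    [/\ forall i, (i <= n)%N -> gorenstein_flat (G i),
        forall i, (n < i)%N -> forall x : G i, x = 0,
        forall i, exact_at (d i.+1) (d i),
        exact_at (d 0%N) e &
        surj e].

(* N extended with infinity, the latter being None. *)
Definition enat := option nat.

Definition le_enat (x y : enat) : Prop :=
  match x, y with
  | _, None => True
  | None, Some _ => False
  | Some a, Some b => (a <= b)%N
  end.

Definition enat_inf (P : nat -> Prop) : enat :=
  if pselect (exists n, `[< P n >]) is left h then Some (ex_minn h) else None.

Definition enat_sup (A : set enat) : enat :=
  enat_inf (fun n => forall x, A x -> le_enat x (Some n)).

Lemma le_enat_sup (A : set enat) x : A x -> le_enat x (enat_sup A).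
Proof.
rewrite /enat_sup /enat_inf; case: pselect => [h|_] Ax; last by case: x Ax.
by case: ex_minnP => n /asboolP hn _; apply: hn.
Qed.

Lemma enat_sup_le (A : set enat) y :
  (forall x, A x -> le_enat x y) -> le_enat (enat_sup A) y.
Proof.
rewrite /enat_sup /enat_inf; case: y => [b|] hb; last by case: pselect.
case: pselect => [h|[]]; last by exists b; apply/asboolP.
by case: ex_minnP => n _ hn; apply/hn/asboolP.
Qed.

Definition Gfd (R : comPzRingType) (M : lmodType R) : enat :=
  enat_inf (gorenstein_flat_resolution M).

Definition Gwdim (R : comPzRingType) : enat :=
  enat_sup [set x | exists M : lmodType R, x = Gfd M].

(* Main.v *)
From HB Require Import structures.
Require Import Defs.
From mathcomp Require Import all_boot all_order all_algebra.
From mathcomp Require Import boolp classical_sets.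
From mathcomp.multinomials Require Import freeg.

Set Implicit Arguments.
Unset Strict Implicit.
Unset Printing Implicit Defensive.
Import GRing.Theory.
Local Open Scope ring_scope.

(* A module M over the product P of the R_i is the direct sum of its summands
   e_i M, which are R_i-modules, and every R_i-module N is the summand e_i N of
   its restriction along P -> R_i.  A P-linear sequence is exact if and only if
   its components are, and the component of A (x)_P B is the tensor product
   over R_i of those of A and B; hence flatness, injectivity and the Gorenstein
   flat complexes and resolutions can all be moved between P and the R_i.
   Restricting R_i-modules to P and taking their e_i-summands back gives one
   inequality, gluing resolutions of the summands of a P-module the other. *)

(** * Transfer of exactness and of images *)

(** Exactness passes to a retract: a cycle below is lifted by [sB], acquires a preimage above, and
    [pA] brings this preimage down. That the composite is zero is checked after the injective map
    [sC]. *)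
Lemma exact_at_retract (A B C A' B' C' : zmodType)
    (f : {additive A -> B}) (g : {additive B -> C})
    (f' : {additive A' -> B'}) (g' : {additive B' -> C'})
    (pA : A -> A') (pB : B -> B') (pC : C -> C')
    (sA : A' -> A) (sB : B' -> B) (sC : {additive C' -> C}) :
  cancel sB pB -> cancel sC pC ->
  (forall x, pB (f x) = f' (pA x)) ->
  (forall x, sB (f' x) = f (sA x)) -> (forall x, sC (g' x) = g (sB x)) ->
  exact_at f g -> exact_at f' g'.
Proof.
move=> sBK sCK pf sf sg fg y; split=> [gy|[x <-]].
  have /fg[x fx] : g (sB y) = 0 by rewrite -sg gy raddf0.
  by exists (pA x); rewrite -pf fx sBK.
apply: (can_inj sCK); rewrite sg sf raddf0.
by apply/fg; exists (sA x).
Qed.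

(** A cycle [y] is the sum of its parts [sB i (pB i y)]. Each component [pB i y] is a cycle, so a
    preimage is chosen in each component, and the chosen preimages are added up in [A]. *)
Lemma exact_at_sum (I : finType) (A B C : zmodType) (A' B' C' : I -> zmodType)
    (f : {additive A -> B}) (g : {additive B -> C})
    (f' : forall i, {additive A' i -> B' i})
    (g' : forall i, {additive B' i -> C' i})
    (pA : forall i, A -> A' i) (pB : forall i, B -> B' i)
    (pC : forall i, {additive C -> C' i})
    (sA : forall i, A' i -> A) (sB : forall i, B' i -> B)
    (sC : forall i, {additive C' i -> C}) :
  (forall y, \sum_i sB i (pB i y) = y) ->
  (forall z, \sum_i sC i (pC i z) = z) ->
  (forall i x, pB i (f x) = f' i (pA i x)) ->
  (forall i x, pC i (g x) = g' i (pB i x)) ->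
  (forall i x, sB i (f' i x) = f (sA i x)) ->
  (forall i, exact_at (f' i) (g' i)) -> exact_at f g.
Proof.
move=> sumB sumC pf pg sf fg y; split=> [gy|[x <-]].
  have Hx i : exists x, f' i x = pB i y by apply/fg; rewrite -pg gy raddf0.
  exists (\sum_i sA i (sval (cid (Hx i)))); rewrite raddf_sum -[RHS]sumB.
  by apply: eq_bigr => i _; rewrite -sf (svalP (cid (Hx i))).
rewrite -[LHS]sumC big1 // => i _; rewrite pg pf.
have -> : g' i (f' i (pA i x)) = 0 by apply/fg; exists (pA i x).
by rewrite raddf0.
Qed.

(** Trades an isomorphism onto the image for an injection into [N] with the same image. In this form
    the condition can be moved between rings without handling submodule types. *)
Lemma isomorphic_image (R : pzRingType) (M A N : lmodType R)
    (f : {linear A -> N}) :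
  isomorphic M (image_mod f) <->
  exists2 h : {linear M -> N}, injective h &
    forall y, (exists x, h x = y) <-> (exists x, f x = y).
Proof.
split=> [[p [q pK qK]]|[h h_inj im]].
  exists (val \o p : {linear M -> N}) => [|y].
    by move=> x y /= /val_inj; apply: (can_inj pK).
  split=> [[x <-]|fy]; first exact/asboolP/(valP (p x)).
  have yP : y \in image_pred f by apply/asboolP.
  by exists (q (Submod yP)); rewrite /= qK.
have hP x : h x \in image_pred f by apply/asboolP/im; exists x.
pose p x : image_mod f := Submod (hP x).
have p_add : zmod_morphism p by move=> x y; apply: val_inj; apply: (raddfB h).
have p_scal : scalable p by move=> a x; apply: val_inj; apply: linearZZ.
pose pA := GRing.isZmodMorphism.Build _ _ p p_add.
pose pS := GRing.isScalable.Build _ _ _ _ p p_scal.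
pose p' : {linear M -> image_mod f} := HB.pack p pA pS.
have p_surj z : exists x, p x = z.
  case: z => y yP; have /im[x hx] : exists x, f x = y by apply/asboolP.
  by exists x; apply: val_inj.
exists p', (fun z => sval (cid (p_surj z))) => [x|z].
  by apply: h_inj; move/(congr1 val): (svalP (cid (p_surj (p x)))).
exact: (svalP (cid (p_surj z))).
Qed.

(** * Tensor products *)

Section TensorTheory.
Variables (R : comPzRingType) (A B : lmodType R).

Lemma tensDl (a a' : A) (b : B) : tens (a + a') b = tens a b + tens a' b.
Proof.
apply/eqP; rewrite /tens -raddfD -Quotient.idealrBE opprD addrA.
exact/asboolP/TensorDl.
Qed.

Lemma tensDr (a : A) (b b' : B) : tens a (b + b') = tens a b + tens a b'.
Proof.
apply/eqP; rewrite /tens -raddfD -Quotient.idealrBE opprD addrA.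
exact/asboolP/TensorDr.
Qed.

Lemma tensZ r (a : A) (b : B) : tens (r *: a) b = tens a (r *: b).
Proof.
by apply/eqP; rewrite /tens -Quotient.idealrBE; apply/asboolP/TensorZ.
Qed.

(** Pure tensors generate the tensor product as an abelian group. *)
Lemma tensor_ext (Z : zmodType) (f g : {additive tensor A B -> Z}) :
  (forall a b, f (tens a b) = g (tens a b)) -> f =1 g.
Proof.
move=> fg; elim/quotW => u.
elim/freeg_ind_dom0: u => [|k [a b] u _ _ IH]; first by rewrite !raddf0.
(* The coefficient [k] is an integer, so the term is a [k]-fold multiple of a generator and
   additivity suffices. *)
rewrite -[k in << k *g _ >>]intz -freegU_mulz !raddfD IH; congr (_ + _).
by rewrite !raddfMz; congr (_ *~ _); apply: fg.
Qed.

(** The universal property of the tensor product for balanced biadditive maps, stated with a sigma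
    type so that the induced map can be used in definitions. *)
Lemma tensor_lift (Z : zmodType) (h : A -> B -> Z) :
  (forall b, {morph h^~ b : a a' / a + a'}) ->
  (forall a, {morph h a : b b' / b + b'}) ->
  (forall r a b, h (r *: a) b = h a (r *: b)) ->
  {f : {additive tensor A B -> Z} | forall a b, f (tens a b) = h a b}.
Proof.
move=> hDl hDr hZ.
(* [zmodule Z] is [Z] seen as a module over the integers, the target that [fglift] expects. *)
pose F : {freeg (A * B)%type / int} -> zmodule Z :=
  fglift (fun p => h p.1 p.2 : zmodule Z).
have F_add : zmod_morphism F by apply: lift_is_additive.
pose FA := GRing.isZmodMorphism.Build _ _ F F_add.
pose F' : {additive _ -> _} := HB.pack F FA.
have FU p : F << p >> = h p.1 p.2 by rewrite /F liftU scale1r.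
have F_rel u : tensor_rel u -> F u = 0.
  elim=> {u} [|u v _ hu _ hv|a a' b|a b b'|r a b].
  - exact: (raddf0 F').
  - by rewrite F_add hu hv subrr.
  - by rewrite !F_add !FU /= hDl [X in X - _ - _]addrC addrK subrr.
  - by rewrite !F_add !FU /= hDr [X in X - _ - _]addrC addrK subrr.
  - by rewrite !F_add !FU /= hZ subrr.
pose G (t : tensor A B) : Z := F (repr t).
have GE u : G (\pi_(tensor A B)%qT u) = F u.
  (* The representative of the class of [u] differs from [u] by a bilinearity relation, on which [F]
     vanishes. *)
  apply/eqP; rewrite -subr_eq0 -F_add; apply/eqP/F_rel/asboolP.
  by rewrite -[asbool _]/(_ \in @tensor_relb _ A B) Quotient.idealrBE reprK.
have G_add : zmod_morphism G.
  by elim/quotW=> u; elim/quotW=> v; rewrite -raddfB !GE F_add.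
pose GA := GRing.isZmodMorphism.Build _ _ G G_add.
pose G' : {additive _ -> _} := HB.pack G GA.
by exists G' => a b; rewrite /= GE FU.
Qed.

End TensorTheory.

(** * Summands cut out by an idempotent of the ring *)

(* A unital surjection P -> R with a section which is not unital: finj 1 is the
   idempotent cutting R out of P, and P is R times another ring. *)
Record factor (P R : comPzRingType) := Factor {
  fproj : {rmorphism P -> R};
  finj : {additive R -> P};
  finjK : cancel finj fproj;
  fprojK : forall a, finj (fproj a) = finj 1 * a }.

Section Factor.
Variables (P R : comPzRingType) (k : factor P R).

Lemma finj1M r : finj k 1 * finj k r = finj k r.
Proof. by rewrite -fprojK finjK. Qed.

(** Although [finj] is only assumed additive, [finj] after [fproj] is multiplication by the
    idempotent, which acts as the identity on the image of [finj]. *)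
Lemma finjM r r' : finj k (r * r') = finj k r * finj k r'.
Proof.
by rewrite -{1}(finjK k r) -{1}(finjK k r') -rmorphM fprojK mulrA finj1M.
Qed.

(* X is the summand e M of M, where e = finj k 1. *)
Record component (M : lmodType P) (X : lmodType R) := Component {
  cproj : {additive M -> X};
  cinj : {additive X -> M};
  cprojZ : forall a x, cproj (a *: x) = fproj k a *: cproj x;
  cinjK : cancel cinj cproj;
  cprojK : forall x, cinj (cproj x) = finj k 1 *: x }.

Section ComponentTheory.
Variables (M : lmodType P) (X : lmodType R) (c : component M X).

Lemma cinj1 x : finj k 1 *: cinj c x = cinj c x.
Proof. by rewrite -(cprojK c) cinjK. Qed.

Lemma cinjZ r x : cinj c (r *: x) = finj k r *: cinj c x.
Proof.
by rewrite -{1}(finjK k r) -{1}(cinjK c x) -cprojZ cprojK scalerA finj1M.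
Qed.

(** This is [P]-linearity of [cinj] when [P] acts on [X] through [fproj]. *)
Lemma cinj_fproj a x : cinj c (fproj k a *: x) = a *: cinj c x.
Proof. by rewrite cinjZ fprojK mulrC -scalerA cinj1. Qed.

End ComponentTheory.

Section ComponentMap.
Variables (M N : lmodType P) (X Y : lmodType R).
Variables (c : component M X) (c' : component N Y) (f : {linear M -> N}).

Definition cmap (x : X) : Y := cproj c' (f (cinj c x)).

Fact cmap_is_zmod_morphism : zmod_morphism cmap.
Proof. by move=> x y; rewrite /cmap !raddfB. Qed.

Fact cmap_is_scalable : scalable cmap.
Proof. by move=> r x; rewrite /cmap cinjZ linearZ /= cprojZ finjK. Qed.

HB.instance Definition _ := GRing.isZmodMorphism.Build _ _ cmap
  cmap_is_zmod_morphism.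
HB.instance Definition _ := GRing.isScalable.Build _ _ _ _ cmap
  cmap_is_scalable.

End ComponentMap.

(** * Maps and exact sequences under passage to a component *)

(** A relation rather than the function [cmap], because [f'] is sometimes given first, as for
    restricted and glued maps. *)
Definition compat (M N : lmodType P) (X Y : lmodType R) (c : component M X)
    (c' : component N Y) (f : M -> N) (f' : X -> Y) : Prop :=
  forall x, cproj c' (f x) = f' (cproj c x).

Lemma compat_cmap (M N : lmodType P) (X Y : lmodType R) (c : component M X)
    (c' : component N Y) (f : {linear M -> N}) :
  compat c c' f (cmap c c' f).
Proof.
by move=> x; rewrite /= /cmap cprojK linearZ /= cprojZ finjK scale1r.
Qed.

(** A [P]-linear map commutes with the idempotent, hence the square of projections yields the square
    of injections. *)
Lemma compat_cinj (M N : lmodType P) (X Y : lmodType R) (c : component M X)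
    (c' : component N Y) (f : {linear M -> N}) (f' : X -> Y) :
  compat c c' f f' -> forall x, cinj c' (f' x) = f (cinj c x).
Proof.
by move=> ff' x; rewrite -{1}(cinjK c x) -ff' cprojK -linearZ /= cinj1.
Qed.

Lemma compat_image (M N : lmodType P) (X Y : lmodType R) (c : component M X)
    (c' : component N Y) (f : {linear M -> N}) (f' : {linear X -> Y}) y :
  compat c c' f f' ->
  (exists x, f x = cinj c' y) <-> (exists x, f' x = y).
Proof.
move=> ff'; split=> [[x fx]|[x <-]].
  by exists (cproj c x); rewrite -ff' fx cinjK.
by exists (cinj c x); rewrite (compat_cinj ff').
Qed.

Lemma compat_exact (M M' M'' : lmodType P) (X X' X'' : lmodType R)
    (c : component M X) (c' : component M' X') (c'' : component M'' X'')
    (f : {linear M -> M'}) (g : {linear M' -> M''})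
    (f' : {linear X -> X'}) (g' : {linear X' -> X''}) :
  compat c c' f f' -> compat c' c'' g g' -> exact_at f g -> exact_at f' g'.
Proof.
move=> ff' gg'; apply: (exact_at_retract (pA := cproj c) (pB := cproj c')
  (pC := cproj c'') (sA := cinj c) (sB := cinj c') (sC := cinj c'')).
- exact: cinjK.
- exact: cinjK.
- exact: ff'.
- exact: compat_cinj.
- exact: compat_cinj.
Qed.

(** * Tensor products of components *)

Section ComponentTensor.
Variables (M N : lmodType P) (X Y : lmodType R).
Variables (c : component M X) (d : component N Y).

Fact tensor_cproj_subproof :
  {f : {additive tensor M N -> tensor X Y} |
    forall m n, f (tens m n) = tens (cproj c m) (cproj d n)}.
Proof.
apply: tensor_lift => [b a a'|a b b'|r a b].
- by rewrite raddfD tensDl.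
- by rewrite raddfD tensDr.
- by rewrite !cprojZ tensZ.
Qed.

Fact tensor_cinj_subproof :
  {f : {additive tensor X Y -> tensor M N} |
    forall x y, f (tens x y) = tens (cinj c x) (cinj d y)}.
Proof.
apply: tensor_lift => [b a a'|a b b'|r a b].
- by rewrite raddfD tensDl.
- by rewrite raddfD tensDr.
- by rewrite !cinjZ tensZ.
Qed.

Definition tensor_cproj := sval tensor_cproj_subproof.
Definition tensor_cinj := sval tensor_cinj_subproof.

Lemma tensor_cprojE m n :
  tensor_cproj (tens m n) = tens (cproj c m) (cproj d n).
Proof. exact: (svalP tensor_cproj_subproof). Qed.

Lemma tensor_cinjE x y :
  tensor_cinj (tens x y) = tens (cinj c x) (cinj d y).
Proof. exact: (svalP tensor_cinj_subproof). Qed.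

Lemma tensor_cinjK : cancel tensor_cinj tensor_cproj.
Proof.
apply: (tensor_ext (f := tensor_cproj \o tensor_cinj) (g := idfun)) => x y /=.
by rewrite tensor_cinjE tensor_cprojE !cinjK.
Qed.

End ComponentTensor.

Section ComponentTensorMap.
Variables (M M' N : lmodType P) (X X' Y : lmodType R).
Variables (c : component M X) (c' : component M' X') (d : component N Y).
Variables (f : {linear M -> M'}) (f' : {linear X -> X'}).
Hypothesis ff' : compat c c' f f'.

Lemma tensor_compat t :
  tensor_cproj c' d (tensor_map f t) = tensor_map f' (tensor_cproj c d t).
Proof.
apply: (tensor_ext (f := tensor_cproj c' d \o tensor_map f)
  (g := tensor_map f' \o tensor_cproj c d)) => m n /=.
by rewrite tensor_cprojE !tensor_map_tens tensor_cprojE ff'.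
Qed.

Lemma tensor_compat_cinj t :
  tensor_cinj c' d (tensor_map f' t) = tensor_map f (tensor_cinj c d t).
Proof.
apply: (tensor_ext (f := tensor_cinj c' d \o tensor_map f')
  (g := tensor_map f \o tensor_cinj c d)) => x y /=.
by rewrite tensor_cinjE !tensor_map_tens tensor_cinjE (compat_cinj ff').
Qed.

End ComponentTensorMap.

(** The sequence tensored over [R] is a retract of the sequence tensored over [P]. *)
Lemma tensor_compat_exact (M M' M'' N : lmodType P) (X X' X'' Y : lmodType R)
    (c : component M X) (c' : component M' X') (c'' : component M'' X'')
    (d : component N Y) (f : {linear M -> M'}) (g : {linear M' -> M''})
    (f' : {linear X -> X'}) (g' : {linear X' -> X''}) :
  compat c c' f f' -> compat c' c'' g g' ->
  exact_at (tensor_map (B := N) f) (tensor_map (B := N) g) ->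
  exact_at (tensor_map (B := Y) f') (tensor_map (B := Y) g').
Proof.
move=> ff' gg'; apply: (exact_at_retract
  (pA := tensor_cproj c d) (pB := tensor_cproj c' d)
  (pC := tensor_cproj c'' d) (sA := tensor_cinj c d)
  (sB := tensor_cinj c' d) (sC := tensor_cinj c'' d)).
- exact: tensor_cinjK.
- exact: tensor_cinjK.
- exact: tensor_compat.
- exact: tensor_compat_cinj.
- exact: tensor_compat_cinj.
Qed.

(** * Restriction of scalars along [fproj] *)

Section Restriction.
Variable N : lmodType R.

(* The unused argument carries the P-module structure. *)
Definition restr of factor P R : Type := N.
Local Notation rN := (restr k).

HB.instance Definition _ := GRing.Zmodule.copy rN N.

Definition restr_scale (a : P) (x : rN) : rN := fproj k a *: (x : N).

Fact restr_scaleA a b x :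
  restr_scale a (restr_scale b x) = restr_scale (a * b) x.
Proof. by rewrite /restr_scale scalerA rmorphM. Qed.
Fact restr_scale1 : left_id 1 restr_scale.
Proof. by move=> x; rewrite /restr_scale rmorph1 scale1r. Qed.
Fact restr_scaleDr : right_distributive restr_scale +%R.
Proof. by move=> a x y; rewrite /restr_scale scalerDr. Qed.
Fact restr_scaleDl x : {morph restr_scale^~ x : a b / a + b}.
Proof. by move=> a b; rewrite /restr_scale rmorphD scalerDl. Qed.

HB.instance Definition _ := GRing.Zmodule_isLmodule.Build P rN
  restr_scaleA restr_scale1 restr_scaleDr restr_scaleDl.

(** The idempotent acts on [rN] as the identity, since [fproj] sends it to 1. The definition is
    transparent so that squares with restricted maps commute by computation. *)
Definition restr_component : component rN N.
Proof.
exists (idfun : {additive N -> N}) (idfun : {additive N -> N}) => //.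
by move=> x /=; rewrite -[RHS]/(fproj k (finj k 1) *: (x : N)) finjK scale1r.
Defined.

End Restriction.

(** * The summand of a [P]-module cut out by the idempotent *)

Section Corner.
Variable M : lmodType P.

(** The image of the idempotent is described as its set of fixed points, so that membership is an
    equation. *)
Definition corner_pred : {pred M} := fun x => finj k 1 *: x == x.

Fact corner_closed : subsemimod_closed (corner_pred).
Proof.
split; last first.
  by move=> a x /eqP ex; apply/eqP; rewrite scalerA mulrC -scalerA ex.
split; first by apply/eqP; rewrite scaler0.
by move=> x y /eqP ex /eqP ey; apply/eqP; rewrite scalerDr ex ey.
Qed.

HB.instance Definition _ :=
  GRing.isSubmodClosed.Build P M (corner_pred) corner_closed.

Definition corner : Type := submod (corner_pred).
Local Notation eM := corner.

HB.instance Definition _ := GRing.Zmodule.copy eM (submod (corner_pred)).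

(** [finj] need not preserve 1; the unit law holds because [finj k 1] fixes every element of the
    corner. *)
Definition corner_scale (r : R) (x : eM) : eM :=
  finj k r *: (x : submod (corner_pred)).

Fact corner_scaleA a b x :
  corner_scale a (corner_scale b x) = corner_scale (a * b) x.
Proof. by rewrite /corner_scale scalerA finjM. Qed.
Fact corner_scale1 : left_id 1 corner_scale.
Proof.
move=> x; apply/val_inj/eqP; rewrite /corner_scale linearZ /=.
exact: (valP x).
Qed.
Fact corner_scaleDr : right_distributive corner_scale +%R.
Proof. by move=> a x y; rewrite /corner_scale scalerDr. Qed.
Fact corner_scaleDl x : {morph corner_scale^~ x : a b / a + b}.
Proof. by move=> a b; rewrite /corner_scale raddfD scalerDl. Qed.

HB.instance Definition _ := GRing.Zmodule_isLmodule.Build R eM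
  corner_scaleA corner_scale1 corner_scaleDr corner_scaleDl.

Fact corner_proj_subproof (x : M) : finj k 1 *: x \in corner_pred.
Proof. by apply/eqP; rewrite scalerA finj1M. Qed.

Definition corner_proj (x : M) : eM := Submod (corner_proj_subproof x).

Fact corner_proj_is_zmod_morphism : zmod_morphism corner_proj.
Proof. by move=> x y; apply: val_inj; rewrite [LHS]scalerBr. Qed.

HB.instance Definition _ := GRing.isZmodMorphism.Build M eM corner_proj
  corner_proj_is_zmod_morphism.

Definition corner_inj (x : eM) : M := submod_val x.

Fact corner_inj_is_zmod_morphism : zmod_morphism corner_inj.
Proof. by []. Qed.

HB.instance Definition _ := GRing.isZmodMorphism.Build eM M corner_inj
  corner_inj_is_zmod_morphism.

Definition corner_component : component M eM.
Proof.
exists (corner_proj : {additive M -> eM}) (corner_inj : {additive eM -> M}).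
- move=> a x; apply: val_inj; rewrite /= /corner_scale linearZ /=.
  by rewrite !scalerA fprojK (mulrC _ a) -mulrA finj1M.
- by move=> x; apply: val_inj; apply/eqP; apply: (valP x).
- by [].
Defined.

End Corner.

(** * Restriction of maps and its adjunctions *)

Section RestrictionMap.
Variables (A B : lmodType R) (f : {linear A -> B}).

Definition restr_map : restr A k -> restr B k := f.

Fact restr_map_is_zmod_morphism : zmod_morphism restr_map.
Proof. by move=> x y; apply: (raddfB f). Qed.

Fact restr_map_is_scalable : scalable restr_map.
Proof. by move=> a x; apply: (linearZZ f). Qed.

HB.instance Definition _ := GRing.isZmodMorphism.Build _ _ restr_map
  restr_map_is_zmod_morphism.
HB.instance Definition _ := GRing.isScalable.Build _ _ _ _ restr_map
  restr_map_is_scalable.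

End RestrictionMap.

(** This lemma and the next three transpose maps along two adjunctions: restriction is left adjoint
    (first two) and right adjoint (last two) to taking the component. *)
Lemma cproj_comp_linear (M : lmodType P) (X Y : lmodType R) (c : component M X)
    (v : {linear restr Y k -> M}) :
  exists w : {linear Y -> X}, forall y, w y = cproj c (v y).
Proof.
pose w (y : Y) := cproj c (v y).
have w_add : zmod_morphism w by move=> y y'; rewrite /w !raddfB.
have w_scal : scalable w.
  move=> r y; rewrite /w -{1}(finjK k r).
  by rewrite -[_ *: y]/(finj k r *: (y : restr Y k)) linearZ /= cprojZ finjK.
pose wA := GRing.isZmodMorphism.Build _ _ w w_add.
pose wS := GRing.isScalable.Build _ _ _ _ w w_scal.
pose w' : {linear Y -> X} := HB.pack w wA wS.
by exists w'.
Qed.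

Lemma cinj_comp_linear (M : lmodType P) (X Y : lmodType R) (c : component M X)
    (u : {linear Y -> X}) :
  exists w : {linear restr Y k -> M}, forall y, w y = cinj c (u y).
Proof.
pose w (y : restr Y k) := cinj c (u y).
have w_add : zmod_morphism w by move=> y y'; rewrite /w !raddfB.
have w_scal : scalable w.
  by move=> a y; rewrite /w -cinj_fproj -linearZ.
pose wA := GRing.isZmodMorphism.Build _ _ w w_add.
pose wS := GRing.isScalable.Build _ _ _ _ w w_scal.
pose w' : {linear restr Y k -> M} := HB.pack w wA wS.
by exists w'.
Qed.

Lemma comp_cproj_linear (M : lmodType P) (X Y : lmodType R) (c : component M X)
    (u : {linear X -> Y}) :
  exists w : {linear M -> restr Y k}, forall x, w x = u (cproj c x).
Proof.
pose w (x : M) : restr Y k := u (cproj c x).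
have w_add : zmod_morphism w by move=> y y'; rewrite /w !raddfB.
have w_scal : scalable w.
  by move=> a y; rewrite /w cprojZ linearZ.
pose wA := GRing.isZmodMorphism.Build _ _ w w_add.
pose wS := GRing.isScalable.Build _ _ _ _ w w_scal.
pose w' : {linear M -> restr Y k} := HB.pack w wA wS.
by exists w'.
Qed.

Lemma comp_cinj_linear (M : lmodType P) (X Y : lmodType R) (c : component M X)
    (u : {linear M -> restr Y k}) :
  exists w : {linear X -> Y}, forall x, w x = u (cinj c x).
Proof.
pose w (x : X) : Y := u (cinj c x).
have w_add : zmod_morphism w by move=> y y'; rewrite /w !raddfB.
have w_scal : scalable w.
  move=> r y; rewrite /w cinjZ linearZ /=.
  by rewrite -[LHS]/(fproj k (finj k r) *: w y) finjK.
pose wA := GRing.isZmodMorphism.Build _ _ w w_add.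
pose wS := GRing.isScalable.Build _ _ _ _ w w_scal.
pose w' : {linear X -> Y} := HB.pack w wA wS.
by exists w'.
Qed.

(** * Injective, flat and Gorenstein flat modules for a single factor *)

(** Taking components is right adjoint to restriction, which preserves injections. *)
Lemma injective_component (E : lmodType P) (X : lmodType R)
    (c : component E X) : injective_module E -> injective_module X.
Proof.
move=> injE A B i u i_inj.
have [w wE] := cinj_comp_linear c u.
have [v vE] := injE _ _ (restr_map i) w i_inj.
have [v' v'E] := cproj_comp_linear c v.
by exists v' => a; rewrite v'E [X in cproj c X]vE wE cinjK.
Qed.

(** Restriction is right adjoint to taking corners, which preserves injections ([ei_inj]). *)
Lemma injective_restr (E : lmodType R) :
  injective_module E -> injective_module (restr E k).
Proof.
move=> injE A B i u i_inj.
pose cA := corner_component A; pose cB := corner_component B.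
have [w wE] := comp_cinj_linear cA u.
have ei_inj : injective (cmap cA cB i).
  move=> x y /(congr1 (cinj cB)).
  rewrite !(compat_cinj (compat_cmap cA cB i)) => /i_inj.
  exact: (can_inj (cinjK cA)).
have [v vE] := injE _ _ (cmap cA cB i) w ei_inj.
have [v' v'E] := comp_cproj_linear cB v.
exists v' => a; rewrite v'E (compat_cmap cA cB i) vE wE cprojK linearZ /=.
by rewrite -[LHS]/(fproj k (finj k 1) *: (u a : E)) finjK scale1r.
Qed.

(** An exact sequence over [R] is still exact over [P], hence after tensoring with [F]; the
    component of the result is the original sequence tensored with [X]. *)
Lemma flat_component (F : lmodType P) (X : lmodType R) (c : component F X) :
  flat F -> flat X.
Proof.
move=> flF A B C f g fg.
apply: (@tensor_compat_exact _ _ _ F _ _ _ X (restr_component A)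
  (restr_component B) (restr_component C) c (restr_map f) (restr_map g)) => //.
exact: flF.
Qed.

(** The corners of the terms form the required complex. An injective [R]-module is tested through
    its restriction, which is injective over [P] and has it as component. *)
Lemma gorenstein_flat_component (M : lmodType P) (X : lmodType R)
    (c : component M X) : gorenstein_flat M -> gorenstein_flat X.
Proof.
move=> [F [d [flF exF /isomorphic_image[h h_inj im] exE]]].
pose cF n := corner_component (F n).
pose eh := cmap c (cF (0 + 1)) h.
have ehE := compat_cmap c (cF (0 + 1)) h.
have edE n := compat_cmap (cF n) (cF (n + 1)) (d n).
exists (fun n => corner (F n) : lmodType R).
exists (fun n => cmap (cF n) (cF (n + 1)) (d n)); split.
- by move=> n; apply: flat_component (cF n) (flF n).
- by move=> n; apply: compat_exact (edE n) (edE (n + 1)) (exF n).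
- apply/isomorphic_image; exists eh => [x y|y].
    move/(congr1 (cinj (cF (0 + 1)))); rewrite !(compat_cinj ehE) => /h_inj.
    exact: (can_inj (cinjK c)).
  by rewrite -(compat_image _ ehE) im (compat_image _ (edE 0)).
- move=> E injE n.
  apply: (tensor_compat_exact (restr_component E) (edE n) (edE (n + 1))).
  exact/exE/injective_restr.
Qed.

Lemma gorenstein_flat_resolution_component (M : lmodType P) (X : lmodType R)
    (c : component M X) n :
  gorenstein_flat_resolution M n -> gorenstein_flat_resolution X n.
Proof.
move=> [G [d [e [gfG G0 exG exe surje]]]].
pose cG n := corner_component (G n).
have edE i := compat_cmap (cG i.+1) (cG i) (d i).
have eeE := compat_cmap (cG 0%N) c e.
exists (fun i => corner (G i) : lmodType R).
exists (fun i => cmap (cG i.+1) (cG i) (d i)), (cmap (cG 0%N) c e); split.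
- by move=> i /gfG; apply: gorenstein_flat_component (cG i).
- move=> i ni x; apply: (can_inj (cinjK (cG i))).
  by rewrite (G0 i ni (cinj _ x)) raddf0.
- by move=> i; apply: compat_exact (edE i.+1) (edE i) (exG i).
- exact: compat_exact (edE 0%N) eeE exe.
- by move=> y; apply/(compat_image _ eeE)/surje.
Qed.

End Factor.

(** * Families of orthogonal idempotents with sum 1 *)

Section Decomposition.
Variables (I : finType) (P : comPzRingType) (R : I -> comPzRingType).
Variable k : forall i, factor P (R i).
Hypothesis sum_finj1 : \sum_i finj (k i) 1 = 1.
Hypothesis fproj_finj1 : forall i j, i != j -> fproj (k j) (finj (k i) 1) = 0.

(** By [sum_finj1] and [fproj_finj1], such a family presents [M] as the direct sum of the [X i]. *)
Definition decomposition (M : lmodType P) (X : forall i, lmodType (R i)) :=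
  forall i, component (k i) M (X i).

Lemma sum_cinj_cproj (M : lmodType P) (X : forall i, lmodType (R i))
    (c : decomposition M X) x : \sum_i cinj (c i) (cproj (c i) x) = x.
Proof.
under eq_bigr do rewrite cprojK.
by rewrite -scaler_suml sum_finj1 scale1r.
Qed.

Lemma cproj_cinj (M : lmodType P) (X : forall i, lmodType (R i))
    (c : decomposition M X) i j (x : X i) :
  i != j -> cproj (c j) (cinj (c i) x) = 0.
Proof. by move=> ij; rewrite -cinj1 cprojZ fproj_finj1 ?scale0r. Qed.

Lemma cproj_sum_cinj (M : lmodType P) (X : forall i, lmodType (R i))
    (c : decomposition M X) (x : forall i, X i) j :
  cproj (c j) (\sum_i cinj (c i) (x i)) = x j.
Proof.
rewrite raddf_sum (bigD1 j) //= cinjK big1 ?addr0 // => i ij.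
exact: cproj_cinj.
Qed.

Lemma cproj_inj (M : lmodType P) (X : forall i, lmodType (R i))
    (c : decomposition M X) x y :
  (forall i, cproj (c i) x = cproj (c i) y) -> x = y.
Proof.
move=> xy; rewrite -(sum_cinj_cproj c x) -(sum_cinj_cproj c y).
by under eq_bigr do rewrite xy.
Qed.

(** With [e_i] the [i]-th idempotent, the [i]-th term on a pure tensor is [e_i m] tensor [e_i n].
    Moving [e_i] to the left factor gives [e_i m] tensor [n], and these add up to [m] tensor [n]. *)
Lemma sum_tensor_cinj_cproj (M N : lmodType P) (X Y : forall i, lmodType (R i))
    (c : decomposition M X) (d : decomposition N Y) t :
  \sum_i tensor_cinj (c i) (d i) (tensor_cproj (c i) (d i) t) = t.
Proof.
pose S (t : tensor M N) :=
  \sum_i tensor_cinj (c i) (d i) (tensor_cproj (c i) (d i) t).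
have S_add : zmod_morphism S.
  by move=> u v; rewrite /S -sumrB; apply: eq_bigr => i _; rewrite !raddfB.
pose SA := GRing.isZmodMorphism.Build _ _ S S_add.
pose S' : {additive _ -> _} := HB.pack S SA.
apply: (tensor_ext (f := S') (g := idfun)) => m n.
rewrite /= /S -[in RHS](sum_cinj_cproj c m).
pose T (m : M) := tens m n.
have T_add : zmod_morphism T.
  by move=> u v; apply/eqP; rewrite -subr_eq opprK -tensDl subrK.
pose TA := GRing.isZmodMorphism.Build _ _ T T_add.
pose T' : {additive _ -> _} := HB.pack T TA.
rewrite [RHS](raddf_sum T'); apply: eq_bigr => i _ /=.
rewrite tensor_cprojE tensor_cinjE [cinj (d i) _]cprojK -tensZ.
by rewrite cinj1.
Qed.

(** * Gluing maps and exact sequences from components *)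

Section Glue.
Variables (M N : lmodType P) (X Y : forall i, lmodType (R i)).
Variables (c : decomposition M X) (d : decomposition N Y).
Variable f : forall i, {linear X i -> Y i}.

Definition glue (x : M) : N := \sum_i cinj (d i) (f i (cproj (c i) x)).

Fact glue_is_zmod_morphism : zmod_morphism glue.
Proof.
by move=> x y; rewrite /glue -sumrB; apply: eq_bigr => i _; rewrite !raddfB.
Qed.

Fact glue_is_scalable : scalable glue.
Proof.
move=> a x; rewrite /glue scaler_sumr; apply: eq_bigr => i _.
by rewrite cprojZ linearZ /= cinj_fproj.
Qed.

HB.instance Definition _ := GRing.isZmodMorphism.Build _ _ glue
  glue_is_zmod_morphism.
HB.instance Definition _ := GRing.isScalable.Build _ _ _ _ glue
  glue_is_scalable.

Lemma compat_glue i : compat (c i) (d i) glue (f i).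
Proof. by move=> x; rewrite /glue cproj_sum_cinj. Qed.

End Glue.

Lemma decomposition_image (M N : lmodType P) (X Y : forall i, lmodType (R i))
    (c : decomposition M X) (d : decomposition N Y) (f : {linear M -> N})
    (f' : forall i, {linear X i -> Y i}) y :
  (forall i, compat (c i) (d i) f (f' i)) ->
  (exists x, f x = y) <-> (forall i, exists x, f' i x = cproj (d i) y).
Proof.
move=> ff'; split=> [[x <-] i|fy]; first by exists (cproj (c i) x); rewrite ff'.
exists (\sum_i cinj (c i) (sval (cid (fy i)))).
apply: (cproj_inj (c := d)) => i.
by rewrite ff' cproj_sum_cinj (svalP (cid (fy i))).
Qed.

Lemma decomposition_exact (M M' M'' : lmodType P)
    (X X' X'' : forall i, lmodType (R i)) (c : decomposition M X)
    (c' : decomposition M' X') (c'' : decomposition M'' X'')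
    (f : {linear M -> M'}) (g : {linear M' -> M''})
    (f' : forall i, {linear X i -> X' i})
    (g' : forall i, {linear X' i -> X'' i}) :
  (forall i, compat (c i) (c' i) f (f' i)) ->
  (forall i, compat (c' i) (c'' i) g (g' i)) ->
  (forall i, exact_at (f' i) (g' i)) -> exact_at f g.
Proof.
move=> ff' gg'; apply: (exact_at_sum
  (pA := fun i => cproj (c i)) (pB := fun i => cproj (c' i))
  (pC := fun i => cproj (c'' i)) (sA := fun i => cinj (c i))
  (sB := fun i => cinj (c' i)) (sC := fun i => cinj (c'' i))).
- exact: sum_cinj_cproj.
- exact: sum_cinj_cproj.
- exact: ff'.
- exact: gg'.
- by move=> i; apply: compat_cinj.
Qed.

Lemma decomposition_tensor_exact (M M' M'' N : lmodType P)
    (X X' X'' Y : forall i, lmodType (R i)) (c : decomposition M X)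
    (c' : decomposition M' X') (c'' : decomposition M'' X'')
    (d : decomposition N Y) (f : {linear M -> M'}) (g : {linear M' -> M''})
    (f' : forall i, {linear X i -> X' i})
    (g' : forall i, {linear X' i -> X'' i}) :
  (forall i, compat (c i) (c' i) f (f' i)) ->
  (forall i, compat (c' i) (c'' i) g (g' i)) ->
  (forall i, exact_at (tensor_map (B := Y i) (f' i))
                      (tensor_map (B := Y i) (g' i))) ->
  exact_at (tensor_map (B := N) f) (tensor_map (B := N) g).
Proof.
move=> ff' gg'; apply: (exact_at_sum
  (pA := fun i => tensor_cproj (c i) (d i))
  (pB := fun i => tensor_cproj (c' i) (d i))
  (pC := fun i => tensor_cproj (c'' i) (d i))
  (sA := fun i => tensor_cinj (c i) (d i))
  (sB := fun i => tensor_cinj (c' i) (d i))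
  (sC := fun i => tensor_cinj (c'' i) (d i))).
- exact: sum_tensor_cinj_cproj.
- exact: sum_tensor_cinj_cproj.
- by move=> i; apply: tensor_compat.
- by move=> i; apply: tensor_compat.
- by move=> i; apply: tensor_compat_cinj.
Qed.

(** An exact sequence over [P] splits into exact sequences of corners; these are tensored with the
    [X i] and reassembled. *)
Lemma decomposition_flat (F : lmodType P) (X : forall i, lmodType (R i))
    (c : decomposition F X) : (forall i, flat (X i)) -> flat F.
Proof.
move=> flX A B C f g fg.
pose cA i := corner_component (k i) A.
pose cB i := corner_component (k i) B.
pose cC i := corner_component (k i) C.
have ff' i := compat_cmap (cA i) (cB i) f.
have gg' i := compat_cmap (cB i) (cC i) g.
apply: (decomposition_tensor_exact c ff' gg') => i.
exact/flX/(compat_exact (ff' i) (gg' i)).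
Qed.

(** * The product of a family of [R i]-modules as a [P]-module *)

Section ProductModule.
Variable X : forall i, lmodType (R i).

(* As in restr, the unused argument carries the P-module structure. *)
Definition prod_mod of (forall i, factor P (R i)) : Type :=
  {dffun forall i, X i}.
Local Notation pX := (prod_mod k).

HB.instance Definition _ := Choice.copy pX {dffun forall i, X i}.

Definition pm_zero : pX := [ffun i => 0 : X i].
Definition pm_opp (x : pX) : pX := [ffun i => - x i].
Definition pm_add (x y : pX) : pX := [ffun i => x i + y i].
Definition pm_scale (a : P) (x : pX) : pX := [ffun i => fproj (k i) a *: x i].

Fact pm_addA : associative pm_add.
Proof. by move=> x y z; apply/ffunP => i; rewrite !ffunE addrA. Qed.
Fact pm_addC : commutative pm_add.
Proof. by move=> x y; apply/ffunP => i; rewrite !ffunE addrC. Qed.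
Fact pm_add0 : left_id pm_zero pm_add.
Proof. by move=> x; apply/ffunP => i; rewrite !ffunE add0r. Qed.
Fact pm_addN : left_inverse pm_zero pm_opp pm_add.
Proof. by move=> x; apply/ffunP => i; rewrite !ffunE addNr. Qed.

HB.instance Definition _ := GRing.isZmodule.Build pX
  pm_addA pm_addC pm_add0 pm_addN.

Fact pm_scaleA a b x : pm_scale a (pm_scale b x) = pm_scale (a * b) x.
Proof. by apply/ffunP => i; rewrite !ffunE scalerA rmorphM. Qed.
Fact pm_scale1 : left_id 1 pm_scale.
Proof. by move=> x; apply/ffunP => i; rewrite !ffunE rmorph1 scale1r. Qed.
Fact pm_scaleDr : right_distributive pm_scale +%R.
Proof. by move=> a x y; apply/ffunP => i; rewrite !ffunE scalerDr. Qed.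
Fact pm_scaleDl x : {morph pm_scale^~ x : a b / a + b}.
Proof. by move=> a b; apply/ffunP => i; rewrite !ffunE rmorphD scalerDl. Qed.

HB.instance Definition _ := GRing.Zmodule_isLmodule.Build P pX
  pm_scaleA pm_scale1 pm_scaleDr pm_scaleDl.

Lemma pm_subE (x y : pX) i : (x - y) i = x i - y i.
Proof. by rewrite !ffunE. Qed.

(** The value [x] is transported from [X i] to [X j] along the equality of indices; on the diagonal
    [eq_axiomK] removes the cast. *)
Definition pm_inj i (x : X i) : pX :=
  [ffun j => if i =P j is ReflectT e then ecast l (X l) e x else 0 : X j].

Lemma pm_injE i (x : X i) : pm_inj x i = x.
Proof. by rewrite ffunE; case: eqP => // e; rewrite eq_axiomK. Qed.

Lemma pm_inj_neq i j (x : X i) : i != j -> pm_inj x j = 0.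
Proof. by move=> ij; rewrite ffunE; case: eqP ij => // ->; rewrite eqxx. Qed.

(** The [i]-th idempotent acts as 1 on coordinate [i] and, by orthogonality, as 0 on the others. *)
Lemma prod_mod_decomposition : decomposition pX X.
Proof.
move=> i.
pose p (x : pX) := x i.
have p_add : zmod_morphism p by move=> x y; apply: pm_subE.
pose pA := GRing.isZmodMorphism.Build _ _ p p_add.
have s_add : zmod_morphism (@pm_inj i).
  move=> x y; apply/ffunP => j; case: (eqVneq i j) => [<-|ij].
    by rewrite pm_subE !pm_injE.
  by rewrite pm_subE !pm_inj_neq // subrr.
pose sA := GRing.isZmodMorphism.Build _ _ (@pm_inj i) s_add.
exists (HB.pack p pA : {additive pX -> X i})
  (HB.pack (@pm_inj i) sA : {additive X i -> pX}) => /=.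
- by move=> a x; rewrite /p ffunE.
- exact: pm_injE.
- move=> x; apply/ffunP => j; case: (eqVneq i j) => [<-|ij].
    by rewrite pm_injE ffunE finjK scale1r.
  by rewrite pm_inj_neq // ffunE fproj_finj1 // scale0r.
Qed.

End ProductModule.

(** * Gluing Gorenstein flat complexes and resolutions *)

Lemma decomposition_gorenstein_flat (M : lmodType P)
    (X : forall i, lmodType (R i)) (c : decomposition M X) :
  (forall i, gorenstein_flat (X i)) -> gorenstein_flat M.
Proof.
move=> gfX.
(* The axiom of choice turns the existence statements into sigma types, so that the complexes form a
   family indexed by [i]. *)
have {gfX} H i : {F : int -> lmodType (R i) &
    {d : forall n, {linear F n -> F (n + 1)} &
    {h : {linear X i -> F (0 + 1)} | [/\ forall n, flat (F n),
      forall n, exact_at (d n) (d (n + 1)),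
      injective h /\ forall y, (exists x, h x = y) <-> (exists x, d 0 x = y) &
      forall E : lmodType (R i), injective_module E ->
        forall n, exact_at (tensor_map (B := E) (d n))
                           (tensor_map (B := E) (d (n + 1)))]}}}.
  have [F /cid[d gfd]] := cid (gfX i); exists F, d; apply: cid.
  by have [? ? /isomorphic_image[h ? ?] ?] := gfd; exists h; split.
pose F i := projT1 (H i); pose d i := projT1 (projT2 (H i)).
pose h i := sval (projT2 (projT2 (H i))).
have gfF i := svalP (projT2 (projT2 (H i))).
pose pF (n : int) : lmodType P := prod_mod (fun i => F i n) k.
pose cF n : decomposition (pF n) (fun i => F i n) := prod_mod_decomposition _.
pose pd n : {linear pF n -> pF (n + 1)} :=
  glue (cF n) (cF (n + 1)) (fun i => d i n).
pose ph : {linear M -> pF (0 + 1)} := glue c (cF (0 + 1)) h.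
have pdE n i : compat (cF n i) (cF (n + 1) i) (pd n) (d i n).
  exact: compat_glue.
have phE i : compat (c i) (cF (0 + 1) i) ph (h i) by apply: compat_glue.
exists pF, pd; split.
- move=> n; apply: (decomposition_flat (cF n)) => i.
  by have [fl _ _ _] := gfF i; apply: fl.
- move=> n; apply: (decomposition_exact (pdE n) (pdE (n + 1))) => i.
  by have [_ ex _ _] := gfF i; apply: ex.
- apply/isomorphic_image; exists ph => [x y hxy|y].
    apply: (cproj_inj (c := c)) => i.
    have [_ _ [h_inj _] _] := gfF i; apply: h_inj.
    by rewrite -[LHS]phE -[RHS]phE hxy.
  rewrite (decomposition_image _ phE) (decomposition_image _ (pdE 0)).
  by split=> im i; have [_ _ [_ himg] _] := gfF i; apply/himg/im.
- move=> E injE n.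
  (* The corners of an injective [P]-module are injective, so each component complex may be tested
     against its own corner. *)
  pose cE i := corner_component (k i) E.
  apply: (decomposition_tensor_exact cE (pdE n) (pdE (n + 1))) => i.
  by have [_ _ _ ex] := gfF i; apply/ex/(injective_component (cE i)).
Qed.

(** The common length [n] allows the resolutions to be glued degree by degree. *)
Lemma decomposition_gorenstein_flat_resolution (M : lmodType P)
    (X : forall i, lmodType (R i)) (c : decomposition M X) n :
  (forall i, gorenstein_flat_resolution (X i) n) ->
  gorenstein_flat_resolution M n.
Proof.
move=> resX.
have {resX} H i : {G : nat -> lmodType (R i) &
    {d : forall j, {linear G j.+1 -> G j} &
    {e : {linear G 0%N -> X i} | [/\
        forall j, (j <= n)%N -> gorenstein_flat (G j),
        forall j, (n < j)%N -> forall x : G j, x = 0,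
        forall j, exact_at (d j.+1) (d j),
        exact_at (d 0%N) e &
        surj e]}}}.
  by have [G /cid[d res]] := cid (resX i); exists G, d; apply: cid.
pose G i := projT1 (H i); pose d i := projT1 (projT2 (H i)).
pose e i := sval (projT2 (projT2 (H i))).
have resG i := svalP (projT2 (projT2 (H i))).
pose pG j : lmodType P := prod_mod (fun i => G i j) k.
pose cG j : decomposition (pG j) (fun i => G i j) := prod_mod_decomposition _.
pose pd j : {linear pG j.+1 -> pG j} := glue (cG j.+1) (cG j) (fun i => d i j).
pose pe : {linear pG 0%N -> M} := glue (cG 0%N) c e.
have pdE j i : compat (cG j.+1 i) (cG j i) (pd j) (d i j) by apply: compat_glue.
have peE i : compat (cG 0%N i) (c i) pe (e i) by apply: compat_glue.
exists pG, pd, pe; split.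
- move=> j jn; apply: (decomposition_gorenstein_flat (cG j)) => i.
  by have [gf _ _ _ _] := resG i; apply: gf.
- move=> j nj x; apply: (cproj_inj (c := cG j)) => i.
  by have [_ G0 _ _ _] := resG i; rewrite [LHS](G0 j nj) [RHS](G0 j nj).
- move=> j; apply: (decomposition_exact (pdE j.+1) (pdE j)) => i.
  by have [_ _ ex _ _] := resG i; apply: ex.
- apply: (decomposition_exact (pdE 0%N) peE) => i.
  by have [_ _ _ ex _] := resG i.
- move=> y; apply/(decomposition_image _ peE) => i.
  by have [_ _ _ _ se] := resG i; apply: se.
Qed.

End Decomposition.

(** * The product ring and its factors *)

Section ProdRingFactor.
Variables (I : finType) (R : I -> comPzRingType).

Definition prod_ring_proj i (x : prod_ring R) : R i := x i.

Fact prod_ring_proj_is_zmod_morphism i : zmod_morphism (@prod_ring_proj i).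
Proof. by move=> x y; rewrite /prod_ring_proj !ffunE. Qed.

Fact prod_ring_proj_is_monoid_morphism i : monoid_morphism (@prod_ring_proj i).
Proof. by split=> [|x y]; rewrite /prod_ring_proj ffunE. Qed.

HB.instance Definition _ i := GRing.isZmodMorphism.Build _ _
  (@prod_ring_proj i) (prod_ring_proj_is_zmod_morphism i).
HB.instance Definition _ i := GRing.isMonoidMorphism.Build _ _
  (@prod_ring_proj i) (prod_ring_proj_is_monoid_morphism i).

Definition prod_ring_inj i (r : R i) : prod_ring R :=
  [ffun j => if i =P j is ReflectT e then ecast l (R l) e r else 0 : R j].

Lemma prod_ring_injE i (r : R i) : prod_ring_inj r i = r.
Proof. by rewrite ffunE; case: eqP => // e; rewrite eq_axiomK. Qed.

Lemma prod_ring_inj_neq i j (r : R i) : i != j -> prod_ring_inj r j = 0.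
Proof. by move=> ij; rewrite ffunE; case: eqP ij => // ->; rewrite eqxx. Qed.

Fact prod_ring_inj_is_zmod_morphism i : zmod_morphism (@prod_ring_inj i).
Proof.
move=> r r'; apply/ffunP => j.
have subE (x y : prod_ring R) : (x - y) j = x j - y j by rewrite !ffunE.
rewrite subE; case: (eqVneq i j) => [<-|ij]; first by rewrite !prod_ring_injE.
by rewrite !prod_ring_inj_neq ?subrr.
Qed.

HB.instance Definition _ i := GRing.isZmodMorphism.Build _ _
  (@prod_ring_inj i) (@prod_ring_inj_is_zmod_morphism i).

Definition prod_ring_factor i : factor (prod_ring R) (R i).
Proof.
exists (@prod_ring_proj i : {rmorphism prod_ring R -> R i})
  (@prod_ring_inj i : {additive R i -> prod_ring R}) => [r|a].
  exact: prod_ring_injE.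
apply/ffunP => j; rewrite [RHS]ffunE /=.
case: (eqVneq i j) => [<-|ij]; first by rewrite !prod_ring_injE mul1r.
by rewrite !prod_ring_inj_neq ?mul0r.
Defined.

Lemma prod_ring_sum_finj1 : \sum_i finj (prod_ring_factor i) 1 = 1.
Proof.
apply/ffunP => j; rewrite -[LHS]/(prod_ring_proj j _) raddf_sum (bigD1 j) //=.
rewrite [X in X + _]prod_ring_injE big1 ?addr0 ?ffunE // => i ij.
exact: prod_ring_inj_neq.
Qed.

Lemma prod_ring_fproj_finj1 i j : i != j ->
  fproj (prod_ring_factor j) (finj (prod_ring_factor i) 1) = 0.
Proof. exact: prod_ring_inj_neq. Qed.

End ProdRingFactor.

(** * Dimensions *)

(** Serves to lengthen resolutions by zero modules. *)
Lemma trivial_gorenstein_flat (R : comPzRingType) (M : lmodType R) :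
  (forall x : M, x = 0) -> gorenstein_flat M.
Proof.
(* All terms of this constant complex are zero, and so are their tensor products, hence exactness is
   automatic. *)
move=> M0; exists (fun=> M), (fun=> idfun : {linear M -> M}).
have t0 (N N' : lmodType R) (t : tensor N N') :
    (forall (x : N) (y : N'), tens x y = 0) -> t = 0.
  move=> xy0; pose z : {additive tensor N N' -> tensor N N'} := \0.
  exact: (tensor_ext (f := idfun) (g := z) xy0).
have tens0r (N : lmodType R) (x : N) (y : M) : tens x y = 0.
  (* Since [y] is zero, [tens x y] added to itself is again [tens x y]. *)
  by apply: (addrI (tens x y)); rewrite -tensDr addr0 !(M0 y) addr0.
have tens0l (N : lmodType R) (x : M) (y : N) : tens x y = 0.
  by apply: (addrI (tens x y)); rewrite -tensDl addr0 !(M0 x) addr0.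
have ex (A B C : zmodType) (f : A -> B) (g : B -> C) :
    (forall x : B, x = 0) -> (forall x : C, x = 0) ->
    f 0 = 0 -> exact_at f g.
  by move=> B0 C0 f0 y; split=> [_|_]; [exists 0; rewrite f0 [RHS]B0|apply: C0].
split.
- by move=> _ A B C f g _; apply: ex; rewrite ?raddf0 // => t; apply: t0.
- by move=> _; apply: ex.
- by apply/isomorphic_image; exists idfun.
- by move=> E _ _; apply: ex; rewrite ?raddf0 // => t; apply: t0.
Qed.

(** The same resolution works: its terms in degrees above [n] are zero, hence Gorenstein flat. This
    monotonicity is what [enat_inf_le] requires. *)
Lemma gorenstein_flat_resolution_leq (R : comPzRingType) (M : lmodType R) n p :
  (n <= p)%N -> gorenstein_flat_resolution M n ->
  gorenstein_flat_resolution M p.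
Proof.
move=> np [G [d [e [gfG G0 exG exe surje]]]]; exists G, d, e; split=> //.
  move=> i _; case: (leqP i n) => [/gfG//|ni].
  exact/trivial_gorenstein_flat/G0.
by move=> i pi; apply/G0/(leq_ltn_trans np).
Qed.

Lemma enat_inf_le (Q : nat -> Prop) n :
  (forall p q, (p <= q)%N -> Q p -> Q q) ->
  le_enat (enat_inf Q) (Some n) <-> Q n.
Proof.
move=> Qle; rewrite /enat_inf; case: pselect => [h|noQ].
  case: ex_minnP => p /asboolP Qp p_min.
  by split=> [pn|Qn]; [apply: Qle Qp|apply/p_min/asboolP].
by split=> // Qn; case: noQ; exists n; apply/asboolP.
Qed.

Lemma enat_sup_leP (A : set enat) y :
  le_enat (enat_sup A) y <-> forall x, A x -> le_enat x y.
Proof.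
split=> [Ay x Ax|]; last exact: enat_sup_le.
move: Ay (le_enat_sup Ax).
case: (enat_sup A) x y {Ax} => [a|] [x|] [y|] //=.
by move=> ay xa; apply: leq_trans ay.
Qed.

(** Eliminates the supremum and the infimum, leaving only resolutions of a fixed length. *)
Lemma Gwdim_leP (R : comPzRingType) n :
  le_enat (Gwdim R) (Some n) <->
  forall M : lmodType R, gorenstein_flat_resolution M n.
Proof.
rewrite /Gwdim enat_sup_leP; split=> [h M|h _ [M ->]].
  apply/enat_inf_le; last by apply: h; exists M.
  by move=> p q; apply: gorenstein_flat_resolution_leq.
apply/enat_inf_le; last exact: h.
by move=> p q; apply: gorenstein_flat_resolution_leq.
Qed.

(** Infinity is the only element with no finite upper bound, and a finite element is its own least
    one. *)
Lemma enat_eq (x y : enat) :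
  (forall n, le_enat x (Some n) <-> le_enat y (Some n)) -> x = y.
Proof.
case: x y => [a|] [b|] //= xy.
- by congr Some; apply/eqP; rewrite eqn_leq; apply/andP; split; apply/xy.
- by case: (xy a) => /(_ (leqnn a)).
- by case: (xy b) => _ /(_ (leqnn b)).
Qed.

Theorem theorem3p5 (m : nat) (m_gt0 : (1 <= m)%N) (R : 'I_m -> comPzRingType)
    (cohR : forall i, coherent (R i)) :
  Gwdim (prod_ring R) = enat_sup [set x | exists i, x = Gwdim (R i)]%classic.
Proof.
(* Both sides are compared through their finite upper bounds [n]. *)
apply: enat_eq => n; rewrite enat_sup_leP Gwdim_leP.
split=> [h _ [i ->]|h M].
  apply/Gwdim_leP => N.
  (* [N] is a component of its restriction to the product, which has a resolution of length [n] by
     [h]. *)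
  pose c := restr_component (prod_ring_factor R i) N.
  exact: (gorenstein_flat_resolution_component c (h _)).
(* Conversely, the corners of [M] have resolutions of length [n], which are glued. *)
pose c i := corner_component (prod_ring_factor R i) M.
apply: (decomposition_gorenstein_flat_resolution (prod_ring_sum_finj1 R)
  (@prod_ring_fproj_finj1 _ R) c) => i.
have /Gwdim_leP hi : le_enat (Gwdim (R i)) (Some n) by apply: h; exists i.
exact: hi.
Qed.
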